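(* Let $k\geq 1$ be an integer and let $G$ be a group containing at least $3k+1$ elements. Then no subset $X\subseteq G$ with $|G\setminus X|=k$ is a minimal complement (left or right) to any subset of $G$. Consequently, if $G$ is a finite group and $X$ is a proper subset of $G$ which is part of a co-minimal pair in $G$, then $|X|<\frac{2}{3}|G|+\frac{1}{3}$.
   Context: Let $(G,\cdot)$ be a group and $A,B$ non-empty subsets. $A$ is a minimal left complement of $B$ if $A\cdot B=G$ and $(A\setminus\{a\})\cdot B\neq G$ for all $a\in A$; $B$ is a minimal right complement of $A$ if $A\cdot B=G$ and $A\cdot(B\setminus\{b\})\neq G$ for all $b\in B$. The pair $(A,B)$ is a co-minimal pair if $A$ is a minimal left complement of $B$ and $B$ is a minimal right complement of $A$; a set $X$ is part of a co-minimal pair if $(X,Y)$ or $(Y,X)$ is a co-minimal pair for some $Y\subseteq G$. *)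

(* Defs.v *)
From mathcomp Require Import all_boot all_order all_algebra all_fingroup.
From mathcomp Require Import boolp classical_sets functions cardinality.

Set Implicit Arguments.
Unset Strict Implicit.
Unset Printing Implicit Defensive.

Local Open Scope classical_set_scope.

Definition setmulg (G : groupType) (A B : set G) : set G :=
  [set (a * b)%g | a in A & b in B].

(* The candidate complement is the first set argument on both sides: here [A]
   is a minimal left complement of [B]; below [B] is a minimal right complement
   of [A], the product being [A * B] in both cases. *)
Definition minimal_left_complement (G : groupType) (A B : set G) : Prop :=
  [/\ A !=set0, B !=set0, setmulg A B = setT
    & forall a, A a -> setmulg (A `\ a) B <> setT].

Definition minimal_right_complement (G : groupType) (B A : set G) : Prop :=
  [/\ A !=set0, B !=set0, setmulg A B = setT
    & forall b, B b -> setmulg A (B `\ b) <> setT].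

Definition co_minimal_pair (G : groupType) (A B : set G) : Prop :=
  minimal_left_complement A B /\ minimal_right_complement B A.

Definition part_of_co_minimal_pair (G : groupType) (X : set G) : Prop :=
  exists Y : set G, co_minimal_pair X Y \/ co_minimal_pair Y X.

(* Main.v *)
Require Import Defs.
From mathcomp Require Import all_boot all_order all_algebra all_fingroup.
From mathcomp Require Import boolp classical_sets functions cardinality.
From mathcomp Require Import zify lra.

(** Let [C] be the complement of [X], with [k] elements, and let [X] be, say, a
    minimal left complement of [B].  By minimality every [x] in [X] has a
    witness [g] such that [x] is the only element of [X] in [g B^-1].  Since
    [C] is non-empty, [B] has two distinct elements [b] and [b']; as [g b^-1]
    and [g b'^-1] are distinct, one of them lies in [C].  Each of the two
    determines [g], hence [x], so [X] injects into two copies of [C], and [G]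
    has at most [3k] elements. *)

Set Implicit Arguments.
Unset Strict Implicit.
Unset Printing Implicit Defensive.

Local Open Scope classical_set_scope.
Local Open Scope card_scope.

(* The left and right cases are [h b g = g * b^-1] and [h b g = b^-1 * g]. *)
Lemma card_le_of_minimal_cover (I T : Type) (h : I -> T -> T) (B : set I)
    (X : set T) (k : nat) :
  (forall i, bijective (h i)) -> (forall g, injective (h^~ g)) ->
  (forall g, exists2 i, B i & X (h i g)) ->
  (forall x, X x -> exists g, forall i, B i -> X (h i g) -> h i g = x) ->
  (0 < k)%N -> ~` X #= `I_k -> [set: T] #<= `I_(3 * k).
Proof.
move=> hbij hinj cover minX k_gt0 /card_set_bijP[e [eC e_inj e_surj]].
have [y Cy _] := e_surj 0%N k_gt0.
have [b Bb _] := cover y.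
(* For the [g] with [h b g = y], [b] does not bring [g] into [X], so the index that does is another
   one. *)
have [b' Bb' b'b] : exists2 i, B i & i <> b.
  have [hV _ hVK] := hbij b.
  have [i Bi Xi] := cover (hV y).
  by exists i => // ib; apply: Cy; rewrite -(hVK y) -ib.
(* Outside [X] the value of [w] is a dummy. *)
have /boolp.choice[w wP] x : exists g,
    X x -> forall i, B i -> X (h i g) -> h i g = x.
  have [/minX[g gP]|nXx] := pselect (X x); first by exists g.
  by exists x => /nXx.
(* Some [h i (w x)] lies in [X] by [cover]; it must equal both [x] and [y']. *)
have w_inj x y' : X x -> X y' -> w x = w y' -> x = y'.
  move=> Xx Xy' wE; have [i Bi Xi] := cover (w x).
  by rewrite -(wP x Xx i Bi Xi) wE (wP y') // -wE.
have wC x : X x -> X (h b (w x)) -> (~` X) (h b' (w x)).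
  move=> Xx Xb Xb'; apply: b'b; apply: (hinj (w x)).
  by rewrite /= (wP x) // (wP x).
(* Three blocks of length [k]: [[0, k)] when [h b (w x)] is in the complement, [[k, 2k)] when only
   [h b' (w x)] is, and [[2k, 3k)] for the complement itself. *)
pose phi x := if `[< X x >] then
    if `[< X (h b (w x)) >] then (e (h b' (w x)) + k)%N else e (h b (w x))
  else (e x + 2 * k)%N.
have eq_e x y' : (~` X) x -> (~` X) y' -> e x = e y' -> x = y'.
  by move=> Cx Cy'; apply: e_inj; rewrite inE.
have eI x : (~` X) x -> (e x < k)%N := eC x.
apply/pcard_leP/injfunPex; exists phi => [x _|x y' _ _]; rewrite /phi /=.
  case: asboolP => Xx; last by have := eI x Xx; lia.
  case: asboolP => Xb; last by have := eI _ Xb; lia.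
  by have := eI _ (wC x Xx Xb); lia.
(* Values in different blocks differ; within a block, [e] is injective, and for points of [X] so are
   [h b] or [h b'] and then [w]. *)
case: (asboolP (X x)) => Xx; case: (asboolP (X y')) => Xy'; last first.
- by move=> eE; apply: eq_e => //; lia.
- have := eI x Xx; case: asboolP => Xb.
    by have := eI _ (wC y' Xy' Xb); lia.
  by have := eI _ Xb; lia.
- have := eI y' Xy'; case: asboolP => Xb.
    by have := eI _ (wC x Xx Xb); lia.
  by have := eI _ Xb; lia.
case: asboolP => Xb; case: asboolP => Xb'.
- move=> /eqP; rewrite eqn_add2r => /eqP/(eq_e _ _ (wC x Xx Xb) (wC y' Xy' Xb')).
  by move/(bij_inj (hbij b')); apply: w_inj.
- by have := eI _ (wC x Xx Xb); have := eI _ Xb'; lia.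
- by have := eI _ (wC y' Xy' Xb'); have := eI _ Xb; lia.
by move/(eq_e _ _ Xb Xb')/(bij_inj (hbij b)); apply: w_inj.
Qed.

Lemma minimal_left_complement_card_le (G : groupType) (X B : set G) (k : nat) :
  minimal_left_complement X B -> (0 < k)%N -> ~` X #= `I_k ->
  [set: G] #<= `I_(3 * k).
Proof.
move=> [_ _ XB minX].
apply: (@card_le_of_minimal_cover G G (fun b g => g * b^-1)%g B).
- move=> b; exists (fun g => g * b)%g => g; first exact: mulgVK.
  exact: mulgK.
- by move=> g a b /mulgI/invg_inj.
- move=> g; have : setmulg X B g by rewrite XB.
  by case=> x Xx [b Bb <-]; exists b; rewrite ?mulgK.
(* The witness is a [g] missed once [x] is removed: a [g * b^-1] in [X] other than [x] would still
   produce it. *)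
- move=> x Xx; have /existsNP[g gP] : ~ forall g, setmulg (X `\ x) B g.
    by move=> all_g; apply: (minX x Xx); apply/seteqP; split.
  exists g => b Bb Xgb; apply: contrapT => gbx; apply: gP.
  by exists (g * b^-1)%g => //; exists b; rewrite ?mulgVK.
Qed.

Lemma minimal_right_complement_card_le (G : groupType) (X B : set G) (k : nat) :
  minimal_right_complement X B -> (0 < k)%N -> ~` X #= `I_k ->
  [set: G] #<= `I_(3 * k).
Proof.
move=> [_ _ BX minX].
apply: (@card_le_of_minimal_cover G G (fun b g => b^-1 * g)%g B).
- move=> b; exists (fun g => b * g)%g => g; first exact: mulKVg.
  exact: mulKg.
- by move=> g a b /mulIg/invg_inj.
- move=> g; have : setmulg B X g by rewrite BX.
  by case=> b Bb [x Xx <-]; exists b; rewrite ?mulKg.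
- move=> x Xx; have /existsNP[g gP] : ~ forall g, setmulg B (X `\ x) g.
    by move=> all_g; apply: (minX x Xx); apply/seteqP; split.
  exists g => b Bb Xgb; apply: contrapT => gbx; apply: gP.
  by exists b => //; exists (b^-1 * g)%g; rewrite ?mulKVg.
Qed.

Lemma card_eq_finset (T : finType) (A : {set T}) : [set` A] #= `I_#|A|.
Proof.
apply/card_set_bijP; exists (index^~ (enum A)); split.
- by move=> x /= Ax; rewrite cardE index_mem mem_enum.
- by move=> x y; rewrite !inE => Ax Ay; apply: (index_inj x); rewrite mem_enum.
- move=> i /=; rewrite cardE => iA.
  have x0 : T by case: (enum A) iA.
  exists (nth x0 (enum A) i); last by rewrite index_uniq ?enum_uniq.
  by rewrite /= -mem_enum mem_nth.
Qed.

Theorem theoremC :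
  (forall (k : nat) (G : groupType),
      (1 <= k)%N ->
      `I_(3 * k + 1) #<= [set: G] ->
      forall X : set G, ~` X #= `I_k ->
        ~ (exists B : set G,
             minimal_left_complement X B \/ minimal_right_complement X B))
  /\
  (forall (G : finGroupType) (X : {set G}),
      X \proper [set: G]%SET ->
      part_of_co_minimal_pair [set` X] ->
      (#|X|%:R < 2 / 3 * #|[set: G]%SET|%:R + 1 / 3 :> rat)%R).
Proof.
split=> [k G k_gt0 kG X CX [B XB]|G X].
  have Gk : [set: G] #<= `I_(3 * k).
    case: XB => XB; first exact: (minimal_left_complement_card_le XB).
    exact: (minimal_right_complement_card_le XB).
  by have := card_le_trans kG Gk; rewrite card_le_II; lia.
rewrite properT => XT XY.
have k_gt0 : (0 < #|~: X|)%N.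
  rewrite card_gt0; apply: contra_neq XT => CX0.
  by rewrite -(finset.setCK X) CX0 finset.setC0.
have CX : ~` [set` X] #= `I_#|~: X|.
  suff -> : ~` [set` X] = [set` ~: X] by exact: card_eq_finset.
  by apply/seteqP; split=> x /=; rewrite finset.in_setC => /negP.
have Gk : [set: G] #<= `I_(3 * #|~: X|).
  (* [X] is a minimal left complement as first member of the pair, a minimal right one as second. *)
  case: XY => Y [[XY _]|[_ XY]].
    exact: (minimal_left_complement_card_le XY).
  exact: (minimal_right_complement_card_le XY).
have : (#|[set: G]%SET| <= 3 * #|~: X|)%N.
  rewrite -card_le_II -(card_le_eql (card_eq_finset _)).
  by apply: card_le_trans Gk; apply: subset_card_le.
rewrite cardsT -(cardsC X) => le3.
(* Subtracting the complement from [le3] gives this bound, which amounts to three times [#|X|] being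
   at most twice the order of [G]. *)
have : (#|X|%:R <= 2 * #|~: X|%:R :> rat)%R.
  by rewrite -GRing.natrM Num.Theory.ler_nat; lia.
rewrite GRing.natrD; lra.
Qed.
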